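(* For real $s>0$ and complex $u$ with $|u|<1$, $$A_s(u)=1-\sum_{n=1}^{\infty}p_{s,n}u^n,$$ where, for every $n\ge1$, $$p_{s,n}=\sum_{k=1}^{n}\frac{(-1)^{k+1}2^k}{(2k+1)^s}\binom{n-1}{k-1}=\frac2{\Gamma(s)}\int_0^1x^2(1-2x^2)^{n-1}(-\log x)^{s-1}\,dx.$$
   Context: For real $s>0$, $F_s$ denotes the analytic function on the half-plane $\operatorname{Re}t>-1$ given by $$F_s(t)=\frac1{\Gamma(s)}\int_0^1\frac{(-\log x)^{s-1}}{1+tx^2}\,dx;$$ it is the analytic extension of $\sum_{k=0}^\infty\frac{(-1)^kt^k}{(2k+1)^s}$, $|t|<1$. For $|u|<1$, $A_s(u)=F_s\!\left(\frac{2u}{1-u}\right)$ (the map $u\mapsto 2u/(1-u)$ sends $|u|<1$ onto $\operatorname{Re}t>-1$). *)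

(* Defs.v *)
From HB Require Import structures.
From mathcomp Require Import all_boot all_order all_algebra.
From mathcomp Require Import all_classical all_reals all_analysis.
From mathcomp Require Export complex.

Set Implicit Arguments.
Unset Strict Implicit.
Unset Printing Implicit Defensive.

Import Order.TTheory GRing.Theory Num.Theory.
Import numFieldNormedType.Exports.

Local Open Scope classical_set_scope.
Local Open Scope ring_scope.
Local Open Scope complex_scope.

Section Definitions.
Context {R : realType}.
Local Notation mu := (@lebesgue_measure R).

Definition Gamma (s : R) : R :=
  \int[mu]_(x in `]0, +oo[) (x `^ (s - 1) * expR (- x)).

Definition Cintegral (D : set R) (f : R -> R[i]) : R[i] :=
  (\int[mu]_(x in D) complex.Re (f x)) +i* (\int[mu]_(x in D) complex.Im (f x)).

(* Only meaningful for s > 0 and Re t > -1.  The end points are left out because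
   there ln and powR take conventional values; this does not affect the
   integral. *)
Definition F (s : R) (t : R[i]) : R[i] :=
  ((Gamma s)^-1)%:C *
  Cintegral `]0, 1[
    (fun x => ((- ln x) `^ (s - 1))%:C / (1 + t * (x ^+ 2)%:C)).

Definition A (s : R) (u : R[i]) : R[i] := F s (2 * u / (1 - u)).

(* Only meaningful for n >= 1, as n.-1 is truncated. *)
Definition p (s : R) (n : nat) : R :=
  \sum_(1 <= k < n.+1)
    (-1) ^+ k.+1 * 2 ^+ k / (2 * k + 1)%:R `^ s * 'C(n.-1, k.-1)%:R.

End Definitions.

(* Main.v *)
Require Import Defs.
From mathcomp Require Import all_boot all_order all_algebra.
From mathcomp Require Import all_classical all_reals all_analysis.
From mathcomp Require Import measurable_realfun ring lra.
Import Order.TTheory GRing.Theory Num.Theory.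
Import numFieldNormedType.Exports.
Local Open Scope classical_set_scope.
Local Open Scope ring_scope.
Local Open Scope complex_scope.

(** Substituting x = exp (- y / (m + 1)) in Euler's integral gives
    [int_0^1 x ^ m (- ln x) ^ (s - 1) dx = Gamma s / (m + 1) ^ s]
    ([log_momentE]).  Hence (- ln x) ^ (s - 1) / Gamma s is a probability
    density on ]0, 1[; let L denote its expectation ([log_mean] on real
    functions, [log_cmean] on complex ones).  Everything follows from linearity
    of L, from L (x ^ m) = (m + 1) ^ (- s), and from the bound of |L f| by a
    multiple of sup |f|.

    Put q = 1 - 2 x ^ 2, so that -1 < q < 1.  The binomial expansion of q ^ n
    turns L (2 x ^ 2 q ^ n) into the finite sum defining p s (n + 1)
    ([p_log_mean]), which is the integral formula.

    For t = 2 u / (1 - u) one computes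
    [1 / (1 + t x ^ 2) = (1 - u) / (1 - u q) = 1 - 2 u x ^ 2 / (1 - u q)],
    and expanding 1 / (1 - u q) as a geometric series with its remainder gives,
    after applying L, the exact identity
    [A s u = 1 - sum_(1 <= k <= n) (p s k) u ^ k - L (e_n)] with
    [e_n = 2 x ^ 2 q ^ n u ^ (n + 1) / (1 - u q)] ([A_partial_sum],
    [remainder]).  Since |1 - u q| >= 1 - |u|, the function e_n is bounded by
    2 |u| ^ (n + 1) / (1 - |u|), so that L (e_n) tends to 0 geometrically
    ([log_cmean_remainder_le]) and no limit has to be exchanged with the
    integral.

    The integral of the density requires that Gamma s be finite and nonzero;
    finiteness comes from an integrable majorant with an explicit bounded
    antiderivative ([gamma_majorant]). *)

(** * Euler's integral and the logarithmic moments *)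

Definition gamma_integrand {R : realType} (s y : R) : R :=
  y `^ (s - 1) * expR (- y).

Definition log_weight {R : realType} (s x : R) : R := (- ln x) `^ (s - 1).

Lemma gamma_integrand_ge0 {R : realType} (s y : R) : 0 <= gamma_integrand s y.
Proof. by rewrite mulr_ge0 ?powR_ge0 ?expR_ge0. Qed.

Lemma measurable_gamma_integrand {R : realType} (s : R) (D : set R) :
  measurable_fun D (gamma_integrand s).
Proof.
apply: (@measurable_funS _ _ _ _ setT) => //.
apply: measurable_funM; first exact: measurable_powR.
by apply: measurableT_comp => //; exact: measurable_funN.
Qed.

Lemma measurable_log_weight {R : realType} (s : R) (D : set R) :
  measurable_fun D (log_weight s).
Proof.
apply: (@measurable_funS _ _ _ _ setT) => //.
apply: (measurableT_comp (measurable_powR (s - 1))).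
apply: measurableT_comp; last exact: measurable_ln.
exact: oppr_measurable.
Qed.

(** The substitution and the fundamental theorem of calculus are applied on
    compact intervals, on which the integrands are continuous although they may
    be singular at 0.  Starting at n + 2 makes each interval nondegenerate. *)
Definition exhaust {R : realType} (n : nat) : set R :=
  `[n.+2%:R^-1, n.+2%:R]%classic.

Lemma exhaust_gt0 {R : realType} n (y : R) : exhaust n y -> 0 < y.
Proof.
by rewrite /exhaust/= in_itv/= => /andP[+ _]; apply: lt_le_trans; rewrite invr_gt0.
Qed.

Lemma exhaust_ltV {R : realType} n : n.+2%:R^-1 < n.+2%:R :> R.
Proof. by rewrite (lt_trans (y := 1)) ?ltr1n// invf_lt1 ?ltr1n. Qed.

Lemma bigcup_exhaust {R : realType} :
  \bigcup_n exhaust n = `]0, +oo[%classic :> set R.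
Proof.
apply/seteqP; split => y.
  by move=> [n _ /exhaust_gt0]; rewrite /= in_itv/= andbT.
rewrite /= in_itv/= andbT => y0.
exists (Num.truncn (Num.max y y^-1)) => //.
rewrite /exhaust/= in_itv/=.
have : Num.max y y^-1 < (Num.truncn (Num.max y y^-1)).+2%:R.
  by apply: lt_trans (truncnS_gt _) _; rewrite ltr_nat.
rewrite gt_max => /andP[h1 h2]; rewrite (ltW h1) andbT.
by rewrite -[leRHS]invrK lef_pV2 ?posrE ?invr_gt0 ?ltW.
Qed.

Lemma nondecreasing_exhaust {R : realType} :
  {homo @exhaust R : n m / (n <= m)%N >-> (n <= m)%O}.
Proof.
move=> n m nm; rewrite subsetEset => y.
rewrite /exhaust/= !in_itv/= => /andP[h1 h2]; apply/andP; split.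
  by apply: le_trans h1; rewrite lef_pV2 ?posrE// ler_nat.
by apply: (le_trans h2); rewrite ler_nat.
Qed.

Lemma cvg_gamma_integral {R : realType} (s : R) :
  (\int[lebesgue_measure]_(y in exhaust n) (gamma_integrand s y)%:E)%E
    @[n --> \oo] -->
  (\int[lebesgue_measure]_(y in `]0%R, +oo[) (gamma_integrand s y)%:E)%E.
Proof.
rewrite -bigcup_exhaust; apply: ge0_nondecreasing_set_cvg_integral => //.
- exact: nondecreasing_exhaust.
- by move=> n; exact: measurable_itv.
- by move=> n; apply/measurable_EFinP; exact: measurable_gamma_integrand.
- by move=> n y _; rewrite lee_fin gamma_integrand_ge0.
Qed.

Lemma is_derive_expRM {R : realType} (k y : R) :
  is_derive y 1 (fun y => expR (k * y)) (k * expR (k * y)).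
Proof.
have h1 : is_derive y 1 (fun y => k * y) k.
  by apply: is_derive_eq; exact: mulr1.
have := @is_derive1_comp _ expR (fun y => k * y) y _ _ (is_derive_expR (k * y)) h1.
by rewrite mulrC; apply.
Qed.

Lemma integral_substitution_expR {R : realType} (k a b : R) (G : R -> R) :
    k < 0 -> a <= b -> {in `[expR (k * b), expR (k * a)], continuous G} ->
  (\int[lebesgue_measure]_(x in `[expR (k * b), expR (k * a)]) (G x)%:E =
   \int[lebesgue_measure]_(y in `[a, b])
     (G (expR (k * y)) * (- k * expR (k * y)))%:E)%E.
Proof.
move=> k0 ab cG; pose E y := expR (k * y).
have dE : (E^`())%classic = fun y => k * E y.
  by apply/funext => y; rewrite derive1E; apply: derive_val; exact: is_derive_expRM.
have derE y : derivable E y 1.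
  have h := is_derive_expRM k y; exact: (@ex_derive _ _ _ _ _ _ _ h).
have cE : continuous E.
  by move=> y; apply: differentiable_continuous; exact/derivable1_diffP.
have cE' : continuous (E^`())%classic.
  rewrite dE => y; apply: (@continuous_comp _ _ _ E ( *%R k)).
    exact: cE.
  exact: mulrl_continuous.
have := @integration_by_substitution_decreasing R E G a b ab.
rewrite {1 2}/E => ->//.
- by apply: eq_integral => y _; rewrite dE /= mulNr.
- by move=> x y _ _ xy; rewrite ltr_expR ltr_nM2l.
- by apply/cvg_ex; exists ((E^`())%classic a); apply: cvg_at_right_filter; exact: cE'.
- by apply/cvg_ex; exists ((E^`())%classic b); apply: cvg_at_left_filter; exact: cE'.
- split; [by move=> y _; exact: derE|by apply: cvg_at_right_filter; exact: cE|].
  by apply: cvg_at_left_filter; exact: cE.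
- by apply: continuous_in_subspaceT => x /set_mem; exact: cG.
Qed.

Lemma continuous_powR {R : realType} (e x : R) : 0 < x ->
  {for x, continuous (fun y => y `^ e)}.
Proof.
move=> x0; apply: differentiable_continuous; apply/derivable1_diffP.
by apply: derivable_powR; rewrite in_itv/= x0.
Qed.

(** The substitution x = exp (- y / (m + 1)), that is y = - (m + 1) ln x,
    has - ln x = y / (m + 1) and dx / dy = - x / (m + 1), which accounts for the
    factor (m + 1) ^ (- s).  The identity, between integrals that may a priori
    be infinite, holds on the compact intervals of an exhausting sequence and
    passes to the limit by monotone convergence. *)
Lemma log_momentE {R : realType} (s : R) (m : nat) :
  (\int[lebesgue_measure]_(x in `]0%R, 1%R[) (x ^+ m * log_weight s x)%:E =
   (m.+1%:R `^ (- s))%:E *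
   \int[lebesgue_measure]_(y in `]0%R, +oo[) (gamma_integrand s y)%:E)%E.
Proof.
pose c : R := m.+1%:R; pose k : R := - c^-1.
have c0 : 0 < c by rewrite ltr0n.
have k0 : k < 0 by rewrite oppr_lt0 invr_gt0.
(* the image of exhaust n under the substitution x = expR (k * y) *)
pose A n : set R := `[expR (k * n.+2%:R), expR (k * n.+2%:R^-1)]%classic.
have lnK' x : 0 < x -> x = expR (k * (k^-1 * ln x)).
  by move=> x0; rewrite mulrA divff ?mul1r ?lnK// lt_eqF.
have A01 n x : A n x -> 0 < x < 1.
  rewrite /A/= in_itv/= => /andP[h1 h2]; apply/andP; split.
    exact: lt_le_trans (expR_gt0 _) h1.
  by apply: le_lt_trans h2 _; rewrite expR_lt1 nmulr_rlt0// invr_gt0.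
have AP n y : A n (expR (k * y)) <-> exhaust n y.
  by rewrite /A /exhaust/= !in_itv/= !ler_expR !ler_nM2l// andbC.
have bigA : \bigcup_n A n = `]0, 1[%classic.
  apply/seteqP; split => x.
    by case=> n _ Anx; rewrite /= in_itv/=; exact: A01 Anx.
  rewrite /= in_itv/= => /andP[x0 x1].
  have : (`]0, +oo[%classic : set R) (k^-1 * ln x).
    by rewrite /= in_itv/= andbT nmulr_rgt0 ?invr_lt0// ln_lt0// x0.
  by rewrite -bigcup_exhaust => -[n _ h]; exists n => //; rewrite (lnK' x x0); apply/AP.
have ndA : {homo A : n m / (n <= m)%N >-> (n <= m)%O}.
  move=> n n' nn'; rewrite subsetEset => x Ax.
  have [x0 _] := andP (A01 _ _ Ax).
  move: Ax; rewrite (lnK' x x0) => /AP Ax; apply/AP.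
  by have := @nondecreasing_exhaust R _ _ nn'; rewrite subsetEset; apply.
have mh D : measurable_fun D (fun x : R => (x ^+ m * log_weight s x)%:E).
  apply/measurable_EFinP; apply: measurable_funM.
    exact: measurable_funX.
  exact: measurable_log_weight.
have lim1 : (\int[lebesgue_measure]_(x in A n) (x ^+ m * log_weight s x)%:E)%E
    @[n --> \oo] -->
    (\int[lebesgue_measure]_(x in `]0%R, 1%R[) (x ^+ m * log_weight s x)%:E)%E.
  rewrite -bigA; apply: ge0_nondecreasing_set_cvg_integral => //.
  - by move=> n; exact: measurable_itv.
  - by move=> n; exact: mh.
  move=> n x xA; have /andP[x0 _] := A01 n x xA; rewrite lee_fin mulr_ge0 ?powR_ge0//.
  by rewrite exprn_ge0 ?ltW.
have lim2 := cvg_gamma_integral s.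
have {}lim2 := cvgeZl (y := (c `^ (- s))%:E) isT lim2.
apply: (cvg_unique _ lim1); first exact: ereal_hausdorff.
apply: cvg_trans lim2; apply: near_eq_cvg; near=> n.
rewrite /A integral_substitution_expR//; last 2 first.
- exact: ltW (exhaust_ltV n).
- move=> x xA; have /andP[x0 x1] := A01 n x xA.
  apply: cvgM; first exact: exprn_continuous.
  apply: (@continuous_comp _ _ _ (fun x : R => - ln x) (fun y => y `^ (s - 1))).
    by apply: cvgN; exact: continuous_ln.
  by apply: continuous_powR; rewrite oppr_gt0 ln_lt0 ?x0.
rewrite -ge0_integralZl//; first last.
- by rewrite lee_fin powR_ge0.
- by move=> y _; rewrite lee_fin gamma_integrand_ge0.
- by apply/measurable_EFinP; exact: measurable_gamma_integrand.
- exact: measurable_itv.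
apply: eq_integral => y /set_mem/exhaust_gt0 y0.
rewrite -EFinM; congr EFin.
rewrite /gamma_integrand /log_weight expRK -mulNr opprK.
rewrite powRM ?invr_ge0 ?(ltW c0) ?(ltW y0)//.
have -> : expR (- y) = expR (k * y) ^+ m * expR (k * y).
  rewrite -exprSr -expRM_natl mulrA mulrN divff ?mulN1r// gt_eqF//.
have -> : c `^ (- s) = (c^-1) `^ (s - 1) * c^-1.
  rewrite -powR_inv1 ?ltW// -powRrM -powRD.
    by congr (_ `^ _); ring.
  by apply/implyP => _; rewrite gt_eqF.
by ring.
Unshelve. all: by end_near.
Qed.

(** * Finiteness and positivity of Gamma *)

(** Raise 1 + y <= a (1 + y / a) <= a exp (y / a) to the power a. *)
Lemma add1_powR_le_expR {R : realType} (a y : R) : 1 <= a -> 0 < y ->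
  (1 + y) `^ a <= a `^ a * expR y.
Proof.
move=> a1 y0; have a0 : 0 < a by rewrite (lt_le_trans _ a1).
have -> : expR y = expR (y / a) `^ a.
  by rewrite -expRM mulrAC -mulrA divff ?mulr1// gt_eqF.
rewrite -powRM ?expR_ge0 ?(ltW a0)//.
rewrite ge0_ler_powR ?nnegrE ?(ltW a0)//.
- by rewrite addr_ge0// ltW.
- by rewrite mulr_ge0 ?expR_ge0// ltW.
apply: (@le_trans _ _ (a * (1 + y / a))).
  by rewrite mulrDr mulr1 mulrCA divff ?mulr1 ?lerD2r// gt_eqF.
by rewrite ler_pM2l// expR_ge1Dx.
Qed.

(** Equal to y ^ (s - 1) (1 + y) ^ (- s - 1) for y > 0; this form is the
    derivative of (y / (1 + y)) ^ s / s, a function bounded by 1 / s. *)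
Definition gamma_majorant {R : realType} (s y : R) : R :=
  (y / (1 + y)) `^ (s - 1) / (1 + y) ^+ 2.

Lemma gamma_integrand_le {R : realType} (s y : R) : 0 < s -> 0 < y ->
  gamma_integrand s y <= (s + 1) `^ (s + 1) * gamma_majorant s y.
Proof.
move=> s0 y0; have y1 : 0 < 1 + y by rewrite addr_gt0.
have -> : gamma_majorant s y = y `^ (s - 1) * ((1 + y) `^ (s + 1))^-1.
  rewrite /gamma_majorant powRM ?invr_ge0 ?(ltW y0) ?(ltW y1)//.
  rewrite -mulrA; congr (_ * _).
  rewrite -[in LHS]powR_inv1 ?(ltW y1)// -powRrM -powR_mulrn ?(ltW y1)//.
  rewrite -!powRN -powRD; first by congr (_ `^ _); ring.
  by apply/implyP => _; rewrite gt_eqF.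
rewrite /gamma_integrand mulrCA ler_wpM2l ?powR_ge0//.
rewrite expRN -[leLHS]mul1r ler_pdivrMr ?expR_gt0// mulrAC.
rewrite ler_pdivlMr ?powR_gt0// mul1r.
by apply: add1_powR_le_expR => //; lra.
Qed.

Lemma is_derive_gamma_majorant {R : realType} (s y : R) : 0 < s -> 0 < y ->
  is_derive y 1 (fun y => s^-1 * (y / (1 + y)) `^ s) (gamma_majorant s y).
Proof.
move=> s0 y0; have y1 : 0 < 1 + y by rewrite addr_gt0.
have h1 : is_derive y 1 (fun y : R => y / (1 + y)) ((1 + y) ^- 2).
  have h : is_derive y 1 (fun y => (1 + y)^-1) (- (1 + y) ^- 2).
    have g : is_derive y 1 (fun y => 1 + y) (1 : R).
      by apply: is_derive_eq; rewrite add0r mulr1.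
    have := @is_deriveV _ (fun y => 1 + y) y 1 1 (lt0r_neq0 y1) g.
    by rewrite /GRing.scale/= mulr1.
  apply: is_derive_eq; rewrite /GRing.scale/= mulr1.
  by field; rewrite gt_eqF.
have yy : 0 < y / (1 + y) by rewrite divr_gt0.
have h2 := is_derive1_powR s yy.
have h3 : is_derive y 1 (fun y => (y / (1 + y)) `^ s)
   (s * (y / (1 + y)) `^ (s - 1) * (1 + y) ^- 2).
  exact: (@is_derive1_comp _ (fun z => z `^ s) (fun y => y / (1 + y)) y _ _ h2 h1).
apply: is_derive_eq; rewrite /GRing.scale/= /gamma_majorant.
by rewrite ?mulr0 ?addr0 !mulrA mulVf ?mul1r// gt_eqF.
Qed.

Lemma continuous_gamma_majorant {R : realType} (s y : R) : 0 < y ->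
  {for y, continuous (gamma_majorant s)}.
Proof.
move=> y0; have y1 : 0 < 1 + y by rewrite addr_gt0.
have c1 : {for y, continuous (fun y : R => 1 + y)}.
  by apply: cvgD; [exact: cvg_cst|exact: cvg_id].
apply: cvgM; last first.
  apply: cvgV; first by rewrite expf_neq0// gt_eqF.
  by apply: (@continuous_comp _ _ _ (fun y : R => 1 + y) (fun z => z ^+ 2)) => //;
     exact: exprn_continuous.
apply: (@continuous_comp _ _ _ (fun y : R => y / (1 + y)) (fun z => z `^ (s - 1))).
  apply: cvgM; first exact: cvg_id.
  by apply: cvgV => //; rewrite gt_eqF.
by apply: continuous_powR; rewrite divr_gt0.
Qed.

Lemma gamma_integral_lty {R : realType} (s : R) : 0 < s ->
  (\int[lebesgue_measure]_(y in `]0%R, +oo[) (gamma_integrand s y)%:E < +oo)%E.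
Proof.
move=> s0.
pose K : R := (s + 1) `^ (s + 1); pose P y : R := s^-1 * (y / (1 + y)) `^ s.
suff h : (\int[lebesgue_measure]_(y in `]0%R, +oo[) (gamma_integrand s y)%:E
    <= (K * s^-1)%:E)%E.
  by apply: le_lt_trans h _; rewrite ltry.
have K0 : 0 <= K by exact: powR_ge0.
have lim2 := cvg_gamma_integral s.
rewrite -(cvg_lim _ lim2)//.
apply: lime_le; first by apply/cvg_ex; eexists; exact: lim2.
near=> n.
have cK : {within exhaust n, continuous (fun y : R => K * gamma_majorant s y)}.
  apply: continuous_in_subspaceT => y /set_mem/exhaust_gt0 y0.
  by apply: cvgM; [exact: cvg_cst|exact: continuous_gamma_majorant].
have dP (y : R) : 0 < y -> is_derive y 1 (fun y => K * P y) (K * gamma_majorant s y).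
  move=> y0; have h := is_derive_gamma_majorant s y s0 y0.
  by apply: is_derive_eq; rewrite ?scaler0 ?addr0.
have Pder (y : R) : 0 < y -> derivable (fun y => K * P y) y 1.
  by move=> y0; have h := dP y y0; exact: (@ex_derive _ _ _ _ _ _ _ h).
have Pcont (y : R) : 0 < y -> {for y, continuous (fun y => K * P y)}.
  by move=> y0; apply: differentiable_continuous; apply/derivable1_diffP; exact: Pder.
apply: (@le_trans _ _ (\int[lebesgue_measure]_(y in exhaust n)
   (K * gamma_majorant s y)%:E)%E).
  apply: ge0_le_integral => //.
  - exact: measurable_itv.
  - by move=> y _; rewrite lee_fin gamma_integrand_ge0.
  - by apply/measurable_EFinP; exact: measurable_gamma_integrand.
  - apply/measurable_EFinP; apply: subspace_continuous_measurable_fun => //.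
    exact: measurable_itv.
  - by move=> y /exhaust_gt0 y0; rewrite lee_fin gamma_integrand_le.
have ab := @exhaust_ltV R n.
have n0 : 0 < n.+2%:R^-1 :> R by rewrite invr_gt0.
have n1 : 0 < n.+2%:R :> R by [].
have PK : (K * P n.+2%:R <= K * s^-1).
  rewrite ler_wpM2l// -[leRHS]mulr1 ler_pM2l ?invr_gt0//.
  rewrite [leRHS](_ : 1 = 1 `^ s); last by rewrite powR1.
  rewrite ge0_ler_powR ?nnegrE ?divr_ge0 ?(ltW s0)//.
  by rewrite ler_pdivrMr ?mul1r ?lerDr ?addr_gt0.
rewrite (@continuous_FTC2 _ _ (fun y => K * P y) _ _ ab cK).
- rewrite -EFinB lee_fin (le_trans _ PK)// gerBl.
  by rewrite !mulr_ge0 ?powR_ge0// invr_ge0 ltW.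
- split.
  + by move=> y; rewrite in_itv/= => /andP[h _]; apply: Pder; apply: lt_trans h.
  + by apply: cvg_at_right_filter; exact: Pcont.
  + by apply: cvg_at_left_filter; exact: Pcont.
- move=> y; rewrite in_itv/= => /andP[h _]; rewrite derive1E.
  by apply: derive_val; apply: dP; apply: lt_trans h.
Unshelve. all: by end_near.
Qed.

(** On [1, 2] the integrand is at least exp (- 2) / 2. *)
Lemma gamma_integral_gt0 {R : realType} (s : R) : 0 < s ->
  (0 < \int[lebesgue_measure]_(y in `]0%R, +oo[) (gamma_integrand s y)%:E)%E.
Proof.
move=> s0; pose c : R := expR (- 2) / 2.
have c0 : 0 < c by rewrite divr_gt0// expR_gt0.
have y12 (y : R) : `[1, 2]%classic y -> 1 <= y <= 2 by rewrite /= in_itv.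
apply: (@lt_le_trans _ _ (\int[lebesgue_measure]_(y in `[1%R, 2%R]) c%:E)%E).
  rewrite integral_cst//= lebesgue_measure_itv/= lte_fin ltr1n -EFinB -EFinM lte_fin.
  by rewrite mulr_gt0// subr_gt0 ltr1n.
apply: (@le_trans _ _
  (\int[lebesgue_measure]_(y in `[1%R, 2%R]) (gamma_integrand s y)%:E)%E).
  apply: ge0_le_integral => //.
  - by move=> y _; rewrite lee_fin ltW.
  - by apply/measurable_EFinP; exact: measurable_gamma_integrand.
  - move=> y /y12/andP[y1 y2].
    have y0 : 0 < y by rewrite (lt_le_trans _ y1).
    rewrite lee_fin /c mulrC ler_pM ?expR_ge0 ?ler_expR ?lerN2//.
    have -> : y `^ (s - 1) = y `^ s / y.
      rewrite powRB ?powRr1 ?(ltW y0)//.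
      by apply/implyP => _; rewrite gt_eqF.
    rewrite (@le_trans _ _ y^-1)//; first by rewrite lef_pV2 ?posrE.
    rewrite -[leLHS]mul1r ler_pM2r ?invr_gt0//.
    rewrite [leLHS](_ : 1 = 1 `^ s); last by rewrite powR1.
    by rewrite ge0_ler_powR ?nnegrE ?(ltW s0) ?(ltW y0).
apply: ge0_subset_integral => //.
- by apply/measurable_EFinP; exact: measurable_gamma_integrand.
- by move=> y _; rewrite lee_fin gamma_integrand_ge0.
- by move=> y /y12/andP[y1 _]; rewrite /= in_itv/= andbT (lt_le_trans _ y1).
Qed.

Lemma gamma_integralE {R : realType} (s : R) : 0 < s ->
  (\int[lebesgue_measure]_(y in `]0%R, +oo[) (gamma_integrand s y)%:E =
   (Gamma s)%:E)%E.
Proof.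
move=> s0; rewrite /Gamma /Rintegral fineK// fin_numElt gamma_integral_lty// andbT.
by rewrite (lt_trans _ (gamma_integral_gt0 s s0)).
Qed.

Lemma Gamma_gt0 {R : realType} (s : R) : 0 < s -> 0 < Gamma s.
Proof. by move=> s0; rewrite -lte_fin -gamma_integralE// gamma_integral_gt0. Qed.

(** * Expectation under the logarithmic density *)

Lemma integral_log_moment {R : realType} (s : R) (m : nat) : 0 < s ->
  (\int[lebesgue_measure]_(x in `]0%R, 1%R[) (x ^+ m * log_weight s x)%:E =
   (Gamma s / m.+1%:R `^ s)%:E)%E.
Proof.
by move=> s0; rewrite log_momentE gamma_integralE// -EFinM powRN mulrC.
Qed.

Lemma integrable_log_weight {R : realType} (s : R) : 0 < s ->
  lebesgue_measure.-integrable `]0%R, 1%R[ (EFin \o log_weight s).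
Proof.
move=> s0; apply/integrableP; split.
  by apply/measurable_EFinP; exact: measurable_log_weight.
have := integral_log_moment s 0 s0.
under eq_integral do rewrite expr0 mul1r.
move=> h; under eq_integral do rewrite /= ger0_norm ?powR_ge0//.
by rewrite h ltry.
Qed.

(** A class of functions integrable against every [log_weight], closed under
    sums and products. *)
Definition bounded_measurable {R : realType} (f : R -> R) : Prop :=
  measurable_fun (`]0, 1[%classic : set R) f /\
  exists M : R, forall x : R, 0 < x < 1 -> `|f x| <= M.

Lemma bounded_measurable_cst {R : realType} (c : R) :
  bounded_measurable (fun=> c).
Proof. by split; [exact: measurable_cst|exists `|c|]. Qed.

Lemma bounded_measurable_id {R : realType} : bounded_measurable (@id R).
Proof.
split; first exact: measurable_id.
by exists 1 => x /andP[x0 x1]; rewrite ger0_norm ltW.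
Qed.

Lemma bounded_measurableD {R : realType} (f g : R -> R) :
  bounded_measurable f -> bounded_measurable g ->
  bounded_measurable (fun x => f x + g x).
Proof.
move=> [mf [M hM]] [mg [N hN]]; split; first exact: measurable_funD.
exists (M + N) => x x01; apply: le_trans (ler_normD _ _) _.
by rewrite lerD ?hM ?hN.
Qed.

Lemma bounded_measurableM {R : realType} (f g : R -> R) :
  bounded_measurable f -> bounded_measurable g ->
  bounded_measurable (fun x => f x * g x).
Proof.
move=> [mf [M hM]] [mg [N hN]]; split; first exact: measurable_funM.
by exists (M * N) => x x01; rewrite normrM ler_pM ?hM ?hN.
Qed.

Lemma bounded_measurableN {R : realType} (f : R -> R) :
  bounded_measurable f -> bounded_measurable (fun x => - f x).
Proof.
move=> /(bounded_measurableM _ _ (bounded_measurable_cst (- 1))).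
by congr bounded_measurable; apply/funext => x; rewrite mulN1r.
Qed.

Lemma bounded_measurableX {R : realType} (f : R -> R) n :
  bounded_measurable f -> bounded_measurable (fun x => f x ^+ n).
Proof.
move=> hf; elim: n => [|n IH].
  by under eq_fun do rewrite expr0; exact: bounded_measurable_cst.
by under eq_fun do rewrite exprS; exact: bounded_measurableM.
Qed.

Lemma bounded_measurable_sum {R : realType} (I : Type) (r : seq I)
    (f : I -> R -> R) :
  (forall i, bounded_measurable (f i)) ->
  bounded_measurable (fun x => \sum_(i <- r) f i x).
Proof.
move=> hf; elim: r => [|i r IH].
  by under eq_fun do rewrite big_nil; exact: bounded_measurable_cst.
by under eq_fun do rewrite big_cons; exact: bounded_measurableD.
Qed.

Lemma integrable_bounded_log_weight {R : realType} (s : R) (f : R -> R) :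
  0 < s -> bounded_measurable f ->
  lebesgue_measure.-integrable `]0%R, 1%R[
    (EFin \o (fun x => f x * log_weight s x)).
Proof.
move=> s0 [mf [M hM]].
have iM : lebesgue_measure.-integrable `]0%R, 1%R[
    (EFin \o (fun x => M * log_weight s x)).
  have h := integrable_log_weight s s0.
  by apply: (fun mD => integrableZl mD M h); exact: measurable_itv.
apply: (le_integrable _ _ _ iM) => //.
- apply/measurable_EFinP; apply: measurable_funM => //.
  exact: measurable_log_weight.
- move=> x; rewrite /= in_itv/= => x01; rewrite lee_fin !normrM ler_wpM2r//.
  exact: le_trans (hM x x01) (ler_norm _).
Qed.

(** The expectation of f under the probability density
    (- ln x) ^ (s - 1) / Gamma s on ]0, 1[. *)
Definition log_mean {R : realType} (s : R) (f : R -> R) : R :=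
  (Gamma s)^-1 * \int[lebesgue_measure]_(x in `]0, 1[) (f x * log_weight s x).

Lemma eq_log_mean {R : realType} (s : R) (f g : R -> R) :
  (forall x, 0 < x < 1 -> f x = g x) -> log_mean s f = log_mean s g.
Proof.
move=> fg; rewrite /log_mean; congr (_ * _); apply: eq_Rintegral => x /set_mem.
by rewrite /= in_itv/= => x01; rewrite fg.
Qed.

Lemma log_meanD {R : realType} (s : R) (f g : R -> R) : 0 < s ->
  bounded_measurable f -> bounded_measurable g ->
  log_mean s (fun x => f x + g x) = log_mean s f + log_mean s g.
Proof.
move=> s0 hf hg; rewrite /log_mean -mulrDr -RintegralD//.
- by congr (_ * _); apply: eq_Rintegral => x _; rewrite mulrDl.
- exact: integrable_bounded_log_weight.
- exact: integrable_bounded_log_weight.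
Qed.

Lemma log_meanZ {R : realType} (s c : R) (f : R -> R) : 0 < s ->
  bounded_measurable f ->
  log_mean s (fun x => c * f x) = c * log_mean s f.
Proof.
move=> s0 hf; rewrite /log_mean mulrCA -(RintegralZl c)//.
- by congr (_ * _); apply: eq_Rintegral => x _; rewrite mulrA.
- exact: integrable_bounded_log_weight.
Qed.

Lemma log_mean_sum {R : realType} (s : R) (I : Type) (r : seq I)
    (f : I -> R -> R) : 0 < s -> (forall i, bounded_measurable (f i)) ->
  log_mean s (fun x => \sum_(i <- r) f i x) = \sum_(i <- r) log_mean s (f i).
Proof.
move=> s0 hf; elim: r => [|i r IH].
  rewrite big_nil (eq_log_mean _ _ (fun x => 0 * 0)).
    by rewrite log_meanZ ?mul0r//; exact: bounded_measurable_cst.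
  by move=> x _; rewrite big_nil mul0r.
rewrite big_cons -IH -log_meanD//.
  by apply: eq_log_mean => x _; rewrite big_cons.
exact: bounded_measurable_sum.
Qed.

Lemma log_mean_exp {R : realType} (s : R) m : 0 < s ->
  log_mean s (fun x => x ^+ m) = (m.+1%:R `^ s)^-1.
Proof.
move=> s0; rewrite /log_mean /Rintegral integral_log_moment//=.
by rewrite mulrA mulVf ?mul1r// gt_eqF// Gamma_gt0.
Qed.

Lemma log_mean1 {R : realType} (s : R) : 0 < s -> log_mean s (fun=> 1) = 1.
Proof.
by move=> s0; rewrite [LHS](log_mean_exp s 0 s0) powR1 invr1.
Qed.

Lemma log_mean_norm_le {R : realType} (s M : R) (f : R -> R) : 0 < s ->
  bounded_measurable f -> (forall x, 0 < x < 1 -> `|f x| <= M) ->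
  `|log_mean s f| <= M.
Proof.
move=> s0 hf fM.
have G0 := Gamma_gt0 s s0.
rewrite /log_mean normrM gtr0_norm ?invr_gt0// ler_pdivrMl//.
apply: le_trans (le_normr_Rintegral _ _) _.
- exact: measurable_itv.
- exact: integrable_bounded_log_weight.
have -> : Gamma s * M = \int[lebesgue_measure]_(x in `]0, 1[) (M * log_weight s x).
  rewrite RintegralZl//; last exact: integrable_log_weight.
  rewrite mulrC; congr (_ * _).
  have /(congr1 ( *%R (Gamma s))) := log_mean1 s s0.
  rewrite mulr1 /log_mean mulrA divff ?mul1r ?gt_eqF// => <-.
  by apply: eq_Rintegral => x _; rewrite mul1r.
apply: le_Rintegral => //.
- have := integrable_bounded_log_weight s f s0 hf => /integrable_norm.
  by apply: eq_integrable => //; exact: measurable_itv.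
- by apply: integrable_bounded_log_weight => //; exact: bounded_measurable_cst.
- move=> x; rewrite /= in_itv/= => x01.
  by rewrite normrM [`|log_weight _ _|]ger0_norm ?powR_ge0// ler_wpM2r ?powR_ge0 ?fM.
Qed.

(** * The integral formula for the coefficients *)

Lemma bounded_measurable_twosqr {R : realType} :
  bounded_measurable (fun x : R => 2 * x ^+ 2).
Proof.
apply: bounded_measurableM; first exact: bounded_measurable_cst.
exact: bounded_measurableX bounded_measurable_id.
Qed.

Lemma bounded_measurable_one_sub_twosqr {R : realType} :
  bounded_measurable (fun x : R => 1 - 2 * x ^+ 2).
Proof.
apply: bounded_measurableD; first exact: bounded_measurable_cst.
exact: bounded_measurableN bounded_measurable_twosqr.
Qed.

Lemma bounded_measurable_kernel {R : realType} n :
  bounded_measurable (fun x : R => 2 * x ^+ 2 * (1 - 2 * x ^+ 2) ^+ n).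
Proof.
apply: bounded_measurableM; first exact: bounded_measurable_twosqr.
exact: bounded_measurableX bounded_measurable_one_sub_twosqr.
Qed.

(** Expand (1 - 2 x ^ 2) ^ n by the binomial theorem; the term of index i gives
    x ^ (2 i + 2), whose expectation is (2 (i + 1) + 1) ^ (- s). *)
Lemma p_log_mean {R : realType} (s : R) n : 0 < s ->
  p s n.+1 = log_mean s (fun x => 2 * x ^+ 2 * (1 - 2 * x ^+ 2) ^+ n).
Proof.
move=> s0.
have -> : (fun x : R => 2 * x ^+ 2 * (1 - 2 * x ^+ 2) ^+ n) = fun x =>
    \sum_(i < n.+1) ((-1) ^+ i * 2 ^+ i.+1 * 'C(n, i)%:R) * x ^+ (2 * i.+1).
  apply/funext => x; rewrite exprDn mulr_sumr; apply: eq_bigr => i _.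
  rewrite expr1n mul1r (exprNn (2 * x ^+ 2)) exprMn -exprM mulnS exprD (exprS 2 i).
  rewrite -mulr_natr.
  by ring.
rewrite log_mean_sum//; last first.
  move=> i; apply: bounded_measurableM; first exact: bounded_measurable_cst.
  exact: bounded_measurableX bounded_measurable_id.
rewrite /p big_add1 big_mkord; apply: eq_bigr => i _.
rewrite log_meanZ//; last exact: bounded_measurableX bounded_measurable_id.
rewrite log_mean_exp//= addn1 !exprS.
by ring.
Qed.

(** * Expectation of complex functions *)

Definition cbounded_measurable {R : realType} (f : R -> R[i]) : Prop :=
  bounded_measurable (fun x => complex.Re (f x)) /\
  bounded_measurable (fun x => complex.Im (f x)).

Definition log_cmean {R : realType} (s : R) (f : R -> R[i]) : R[i] :=
  log_mean s (fun x => complex.Re (f x)) +i*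
  log_mean s (fun x => complex.Im (f x)).

Lemma cbounded_measurable_cst {R : realType} (c : R[i]) :
  cbounded_measurable (fun=> c).
Proof. by split; exact: bounded_measurable_cst. Qed.

Lemma cbounded_measurable_real {R : realType} (f : R -> R) :
  bounded_measurable f -> cbounded_measurable (fun x => (f x)%:C).
Proof. by split => //; exact: bounded_measurable_cst. Qed.

Lemma cbounded_measurableD {R : realType} (f g : R -> R[i]) :
  cbounded_measurable f -> cbounded_measurable g ->
  cbounded_measurable (fun x => f x + g x).
Proof.
have ReD (a b : R[i]) : complex.Re (a + b) = complex.Re a + complex.Re b.
  by case: a b => [? ?] [].
have ImD (a b : R[i]) : complex.Im (a + b) = complex.Im a + complex.Im b.
  by case: a b => [? ?] [].
move=> [f1 f2] [g1 g2]; split.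
  by under eq_fun do rewrite ReD; exact: bounded_measurableD.
by under eq_fun do rewrite ImD; exact: bounded_measurableD.
Qed.

Lemma cbounded_measurableM {R : realType} (f g : R -> R[i]) :
  cbounded_measurable f -> cbounded_measurable g ->
  cbounded_measurable (fun x => f x * g x).
Proof.
have ReM (a b : R[i]) : complex.Re (a * b) =
    complex.Re a * complex.Re b + - (complex.Im a * complex.Im b).
  by case: a b => [? ?] [].
have ImM (a b : R[i]) : complex.Im (a * b) =
    complex.Re a * complex.Im b + complex.Im a * complex.Re b.
  by case: a b => [? ?] [].
move=> [f1 f2] [g1 g2]; split.
  under eq_fun do rewrite ReM; apply: bounded_measurableD.
    exact: bounded_measurableM.
  by apply: bounded_measurableN; exact: bounded_measurableM.
under eq_fun do rewrite ImM; apply: bounded_measurableD; exact: bounded_measurableM.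
Qed.

Lemma normc_ge_Im {R : realType} (z : R[i]) : `|complex.Im z|%:C <= `|z|.
Proof.
case: z => a b; rewrite normc_def lecR /= -sqrtr_sqr ler_wsqrtr//.
by rewrite lerDr sqr_ge0.
Qed.

Lemma cbounded_measurableV {R : realType} (M : R) (f : R -> R[i]) :
  cbounded_measurable f -> (forall x, 0 < x < 1 -> `|(f x)^-1| <= M%:C) ->
  cbounded_measurable (fun x => (f x)^-1).
Proof.
move=> [[f1 _] [f2 _]] fM.
(* the squared modulus, inverted as a real power to get measurability *)
pose D x := complex.Re (f x) ^+ 2 + complex.Im (f x) ^+ 2.
have mD : measurable_fun (`]0, 1[%classic : set R) (fun x => (D x)^-1).
  have -> : (fun x => (D x)^-1) = (fun d => d `^ (-1)) \o D.
    by apply/funext => x /=; rewrite powR_inv1// addr_ge0// sqr_ge0.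
  apply: (measurableT_comp (measurable_powR _)).
  by apply: measurable_funD; exact: measurable_funX.
split; split.
- have -> : (fun x => complex.Re (f x)^-1) = fun x => complex.Re (f x) * (D x)^-1.
    by apply/funext => x; rewrite /D; case: (f x).
  exact: measurable_funM.
- by exists M => x x01; rewrite -lecR; apply: le_trans (fM x x01); exact: normc_ge_Re.
- have -> : (fun x => complex.Im (f x)^-1) = fun x => - complex.Im (f x) * (D x)^-1.
    by apply/funext => x; rewrite /D; case: (f x) => a b; rewrite mulNr.
  by apply: measurable_funM => //; exact: measurable_funN.
- by exists M => x x01; rewrite -lecR; apply: le_trans (fM x x01); exact: normc_ge_Im.
Qed.

Lemma eq_log_cmean {R : realType} (s : R) (f g : R -> R[i]) :
  (forall x, 0 < x < 1 -> f x = g x) -> log_cmean s f = log_cmean s g.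
Proof.
by move=> fg; congr (_ +i* _); apply: eq_log_mean => x x01; rewrite fg.
Qed.

Lemma log_cmeanD {R : realType} (s : R) (f g : R -> R[i]) : 0 < s ->
  cbounded_measurable f -> cbounded_measurable g ->
  log_cmean s (fun x => f x + g x) = log_cmean s f + log_cmean s g.
Proof.
move=> s0 [f1 f2] [g1 g2]; rewrite /log_cmean.
rewrite [RHS](_ : _ = (log_mean s (fun x => complex.Re (f x)) +
  log_mean s (fun x => complex.Re (g x))) +i* (log_mean s (fun x => complex.Im (f x)) +
  log_mean s (fun x => complex.Im (g x))))//.
rewrite -!log_meanD//.
by congr (_ +i* _); apply: eq_log_mean => x _; case: (f x) (g x) => [? ?] [].
Qed.

Lemma cbounded_measurableN {R : realType} (f : R -> R[i]) :
  cbounded_measurable f -> cbounded_measurable (fun x => - f x).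
Proof.
move=> /(cbounded_measurableM _ _ (cbounded_measurable_cst (- 1))).
by congr cbounded_measurable; apply/funext => x; rewrite mulN1r.
Qed.

Lemma log_cmeanN {R : realType} (s : R) (f : R -> R[i]) : 0 < s ->
  cbounded_measurable f ->
  log_cmean s (fun x => - f x) = - log_cmean s f.
Proof.
move=> s0 [f1 f2]; rewrite /log_cmean -[RHS]mulN1r; simpc.
rewrite -[- log_mean s (fun x => complex.Re _)]mulN1r.
rewrite -[- log_mean s (fun x => complex.Im _)]mulN1r -!log_meanZ//.
by congr (_ +i* _); apply: eq_log_mean => x _; case: (f x) => a b; rewrite mulN1r.
Qed.

Lemma log_cmean_real {R : realType} (s : R) (c : R[i]) (f : R -> R) : 0 < s ->
  bounded_measurable f ->
  log_cmean s (fun x => (f x)%:C * c) = (log_mean s f)%:C * c.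
Proof.
move=> s0 hf; case: c => a b.
rewrite [RHS](_ : _ = (a * log_mean s f) +i* (b * log_mean s f)); last first.
  by simpc; congr (_ +i* _); rewrite mulrC.
rewrite -!log_meanZ//; congr (_ +i* _); apply: eq_log_mean => x _ /=; ring.
Qed.

(** Bounding the real and the imaginary part separately costs a factor 2. *)
Lemma log_cmean_norm_le {R : realType} (s M : R) (f : R -> R[i]) : 0 < s ->
  cbounded_measurable f -> (forall x, 0 < x < 1 -> `|f x| <= M%:C) ->
  `|log_cmean s f| <= (2 * M)%:C.
Proof.
move=> s0 [f1 f2] fM.
have le_norm_add (a b : R) : `|a +i* b| <= (`|a| + `|b|)%:C :> R[i].
  rewrite normc_def lecR /= -[leRHS]ger0_norm ?addr_ge0// -sqrtr_sqr.
  apply: ler_wsqrtr; rewrite sqrrD !real_normK ?num_real//.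
  by rewrite -addrA lerD2l lerDr mulrn_wge0// mulr_ge0.
apply: le_trans (le_norm_add _ _) _; rewrite lecR mulrDl mul1r.
rewrite lerD// log_mean_norm_le// => x x01; rewrite -lecR.
  exact: le_trans (normc_ge_Re _) (fM x x01).
exact: le_trans (normc_ge_Im _) (fM x x01).
Qed.

Lemma A_log_cmean {R : realType} (s : R) (u : R[i]) :
  A s u = log_cmean s (fun x => (1 + 2 * u / (1 - u) * (x ^+ 2)%:C)^-1).
Proof.
rewrite /A /F /Cintegral /log_cmean /log_mean; simpc.
congr (_ +i* _); congr (_ * _); apply: eq_Rintegral => x _; rewrite /log_weight.
  by case: (_^-1) => a b; rewrite /=; ring.
by case: (_^-1) => a b; rewrite /=; ring.
Qed.

(** * The geometric expansion and its remainder *)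

Lemma norm_one_sub_mul_ge {R : realType} (u : R[i]) (x : R) : 0 < x < 1 ->
  1 - `|u| <= `|1 - u * (1 - 2 * x ^+ 2)%:C|.
Proof.
move=> /andP[x0 x1].
have q1 : `|(1 - 2 * x ^+ 2)%:C| <= 1 :> R[i].
  rewrite -(rmorph1 (real_complex R)) normc_def lecR /= expr0n addr0 sqrtr_sqr.
  by rewrite ler_norml; apply/andP; split; nra.
have := lerB_normD 1 (- (u * (1 - 2 * x ^+ 2)%:C)).
rewrite normr1 normrN; apply: le_trans.
by rewrite lerD2l lerN2 normrM -[leRHS]mulr1 ler_wpM2l.
Qed.

(** What is left of 1 - 1 / (1 + t x ^ 2) at t = 2 u / (1 - u) once the terms of
    degree at most n in u are removed from its expansion. *)
Definition remainder {R : realType} (u : R[i]) (n : nat) (x : R) : R[i] :=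
  (2 * x ^+ 2 * (1 - 2 * x ^+ 2) ^+ n)%:C * u ^+ n.+1
  * (1 - u * (1 - 2 * x ^+ 2)%:C)^-1.

Lemma one_sub_mul_neq0 {R : realType} (u : R[i]) (x : R) : `|u| < 1 ->
  0 < x < 1 -> 1 - u * (1 - 2 * x ^+ 2)%:C != 0.
Proof.
move=> u1 x01; rewrite -normr_gt0.
by apply: lt_le_trans (norm_one_sub_mul_ge u x x01); rewrite subr_gt0.
Qed.

Lemma norm_one_sub_mul_inv_le {R : realType} (u : R[i]) (r x : R) : `|u| = r%:C -> r < 1 ->
  0 < x < 1 -> `|(1 - u * (1 - 2 * x ^+ 2)%:C)^-1| <= ((1 - r)^-1)%:C.
Proof.
move=> ur r1 x01; rewrite normfV.
have -> : ((1 - r)^-1)%:C = (1 - r%:C)^-1 by rewrite fmorphV rmorphB rmorph1.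
have h := norm_one_sub_mul_ge u x x01.
have r0 : 0 < 1 - r%:C by rewrite subr_gt0 -(rmorph1 (real_complex R)) ltcR.
rewrite ur in h.
by rewrite lef_pV2 ?posrE// (lt_le_trans r0 h).
Qed.

Lemma cbounded_measurable_remainder {R : realType} (u : R[i]) n : `|u| < 1 ->
  cbounded_measurable (remainder u n).
Proof.
move=> u1.
apply: cbounded_measurableM; first apply: cbounded_measurableM.
- apply: cbounded_measurable_real; exact: bounded_measurable_kernel.
- exact: cbounded_measurable_cst.
have ur : `|u| = (complex.Re `|u|)%:C by rewrite RRe_real// normr_real.
apply: (cbounded_measurableV (1 - complex.Re `|u|)^-1); last first.
  move=> x x01; apply: norm_one_sub_mul_inv_le => //.
  by move: u1; rewrite ur -(rmorph1 (real_complex R)) ltcR.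
apply: cbounded_measurableD; first exact: cbounded_measurable_cst.
have -> : (fun x => - (u * (1 - 2 * x ^+ 2)%:C)) =
    fun x => (- u) * (1 - 2 * x ^+ 2)%:C by apply/funext => x; rewrite mulNr.
apply: cbounded_measurableM; first exact: cbounded_measurable_cst.
exact: cbounded_measurable_real bounded_measurable_one_sub_twosqr.
Qed.

Lemma remainder_step {R : realType} (u : R[i]) n x : `|u| < 1 -> 0 < x < 1 ->
  remainder u n x = (2 * x ^+ 2 * (1 - 2 * x ^+ 2) ^+ n)%:C * u ^+ n.+1
                    + remainder u n.+1 x.
Proof.
move=> u1 x01; have h := one_sub_mul_neq0 u x u1 x01.
rewrite /remainder (exprS (1 - _) n) (exprS u n.+1).
set q := 1 - _ in h *; rewrite !(rmorphM (real_complex R)).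
set a := (2 * x ^+ 2)%:C; set b := (q ^+ n)%:C; set v := u ^+ n.+1.
by field.
Qed.

Lemma log_cmean_remainder {R : realType} (s : R) (u : R[i]) n : 0 < s ->
  `|u| < 1 ->
  log_cmean s (remainder u n) =
  (p s n.+1)%:C * u ^+ n.+1 + log_cmean s (remainder u n.+1).
Proof.
move=> s0 u1; have bk := bounded_measurable_kernel (R := R) n.
rewrite p_log_mean// -log_cmean_real// -log_cmeanD//.
- by apply: eq_log_cmean => x x01; exact: remainder_step.
- apply: cbounded_measurableM; last exact: cbounded_measurable_cst.
  exact: cbounded_measurable_real.
- exact: cbounded_measurable_remainder.
Qed.

(** At n = 0 this is the identity
    1 / (1 + t x ^ 2) = 1 - 2 u x ^ 2 / (1 - u q) for t = 2 u / (1 - u); each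
    further step splits off one term of the geometric series. *)
Lemma A_partial_sum {R : realType} (s : R) (u : R[i]) n : 0 < s -> `|u| < 1 ->
  A s u = 1 - \sum_(1 <= k < n.+1) (p s k)%:C * u ^+ k
          - log_cmean s (remainder u n).
Proof.
move=> s0 u1; elim: n => [|n ->]; last first.
  rewrite log_cmean_remainder// [in RHS]big_nat_recr//=; ring.
rewrite big_geq// subr0 A_log_cmean.
have u1' : 1 - u != 0.
  rewrite subr_eq0 eq_sym.
  by apply: contraTneq u1 => ->; rewrite normr1 ltxx.
rewrite (eq_log_cmean _ _ (fun x => 1%:C * 1 + - remainder u 0 x)); last first.
  move=> x x01; have := one_sub_mul_neq0 u x u1 x01.
  rewrite /remainder expr0 expr1 mulr1 !rmorphB !rmorphM !rmorph1 rmorph_nat.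
  by move=> h; field; rewrite h u1'.
have br := cbounded_measurable_remainder u 0 u1.
rewrite (log_cmeanD s (fun=> 1%:C * 1) (fun x => - remainder u 0 x))//;
  last 2 first.
- exact: cbounded_measurable_cst.
- exact: cbounded_measurableN.
rewrite log_cmeanN// (log_cmean_real s 1 (fun=> 1))//;
  last exact: bounded_measurable_cst.
by rewrite log_mean1// mulr1.
Qed.

Lemma log_cmean_remainder_le {R : realType} (s : R) (u : R[i]) (r : R) n :
  0 < s -> `|u| = r%:C -> r < 1 ->
  `|log_cmean s (remainder u n)| <= (4 * r ^+ n.+1 / (1 - r))%:C.
Proof.
move=> s0 ur r1.
have u1 : `|u| < 1 by rewrite ur -(rmorph1 (real_complex R)) ltcR.
have r0 : 0 <= r by rewrite -ler0c -ur.
rewrite [4 * _ / _](_ : _ = 2 * (2 * r ^+ n.+1 / (1 - r))); last by ring.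
apply: log_cmean_norm_le => //; first exact: cbounded_measurable_remainder.
move=> x x01; rewrite /remainder normrM [leRHS]rmorphM.
apply: ler_pM => //; last exact: norm_one_sub_mul_inv_le.
rewrite normrM normrX ur -rmorphXn [leRHS]rmorphM ler_wpM2r ?ler0c ?exprn_ge0//.
rewrite normc_def lecR /= expr0n addr0 sqrtr_sqr normrM normrX.
have /andP[x0 x1] := x01.
rewrite -[leRHS]mulr1 ler_pM// ?exprn_ge0//.
  by rewrite ger0_norm; nra.
by rewrite exprn_ile1// ler_norml; apply/andP; split; nra.
Qed.

Lemma cvg_partial_sums {R : realType} (s : R) (u : R[i]) : 0 < s -> `|u| < 1 ->
  ((fun N => \sum_(1 <= n < N) (p s n)%:C * u ^+ n) : nat -> R[i]^o) @ \oo -->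
    (1 - A s u : R[i]^o).
Proof.
move=> s0 u1.
pose r := complex.Re `|u|.
have ur : `|u| = r%:C by rewrite RRe_real// normr_real.
have r1 : r < 1 by move: u1; rewrite ur -(rmorph1 (real_complex R)) ltcR.
have r0 : 0 <= r by rewrite -ler0c -ur.
have cr : (4 * r ^+ n.+1 / (1 - r)) @[n --> \oo] --> (0 : R).
  rewrite [X in _ --> X](_ : 0 = 4 * 0 / (1 - r)); last by rewrite mulr0 mul0r.
  apply: cvgM; last exact: cvg_cst.
  apply: cvgM; first exact: cvg_cst.
  by rewrite (cvg_shiftS (fun n => r ^+ n)); apply: cvg_expr; rewrite ger0_norm.
rewrite -(cvg_shiftS (fun N => \sum_(1 <= n < N) (p s n)%:C * u ^+ n : R[i]^o)).
apply/cvgrPdist_le => e e0.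
have eE : e = (complex.Re e)%:C by rewrite RRe_real// gtr0_real.
have e0' : 0 < complex.Re e by move: e0; rewrite eE ltcR.
near=> n.
have -> : 1 - A s u - \sum_(1 <= k < n.+1) (p s k)%:C * u ^+ k =
    log_cmean s (remainder u n) by rewrite (A_partial_sum s u n s0 u1); ring.
apply: le_trans (log_cmean_remainder_le s u r n s0 ur r1) _.
rewrite eE lecR; near: n.
have /cvgrPdist_le/(_ _ e0') := cr.
apply: filterS => n; rewrite sub0r normrN; apply: le_trans; exact: ler_norm.
Unshelve. all: by end_near.
Qed.

(* The type R[i]^o is R[i] with the topology given by its absolute value. *)
Theorem theorem3p5 (R : realType) (s : R) (hs : 0 < s) :
  (forall u : R[i], `|u| < 1 ->
     cvgn (fun N => \sum_(1 <= n < N) (p s n)%:C * u ^+ n : R[i]^o) /\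
     A s u = 1 - limn (fun N => \sum_(1 <= n < N) (p s n)%:C * u ^+ n : R[i]^o)) /\
  (forall n : nat, (1 <= n)%N ->
     p s n = 2 / Gamma s *
       \int[@lebesgue_measure R]_(x in `]0, 1[)
         (x ^+ 2 * (1 - 2 * x ^+ 2) ^+ n.-1 * (- ln x) `^ (s - 1))).
Proof.
split=> [u u1|[//|n] _].
  have h := cvg_partial_sums s u hs u1; split.
    by apply/cvg_ex; exists (1 - A s u).
  by rewrite (cvg_lim _ h) ?subKr//; exact: norm_hausdorff.
rewrite p_log_mean// (eq_log_mean s _
  (fun x => 2 * (x ^+ 2 * (1 - 2 * x ^+ 2) ^+ n))); last first.
  by move=> x _; rewrite mulrA.
rewrite log_meanZ// /log_mean ?mulrA//.
apply: bounded_measurableM.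
  exact: bounded_measurableX bounded_measurable_id.
exact: bounded_measurableX bounded_measurable_one_sub_twosqr.
Qed.
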